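(* Let $X$ be a nonempty set, $\Theta$ be a nonempty open interval of $\mathbb{R}$, and $\psi\in\Psi(X,\Theta)$. If $\psi\in\Psi[T_n](X,\Theta)$ for some $n\in\mathbb{N}$, then $\psi\in\Psi[T_m](X,\Theta)$ for any $m\in\{1,\dots,n\}$ that divides $n$.
   Context: $\mathbb{N}$ is the set of positive integers. Point of sign change: for $f:\Theta\to\mathbb{R}$, an element $\vartheta\in\Theta$ is a point of sign change (of decreasing type) for $f$ if $f(t)>0$ for all $t\in\Theta$ with $t<\vartheta$ and $f(t)<0$ for all $t\in\Theta$ with $t>\vartheta$. $\Psi(X,\Theta)$ is the class of functions $\psi:X\times\Theta\to\mathbb{R}$ such that for each $x\in X$ there exist $t_+,t_-\in\Theta$ with $t_+<t_-$ and $\psi(x,t_+)>0>\psi(x,t_-)$. $\psi\in\Psi[T_n](X,\Theta)$ means that $\psi\in\Psi(X,\Theta)$ and for every $(x_1,\ldots,x_n)\in X^n$ the function $\Theta\ni t\mapsto\sum_{i=1}^n\psi(x_i,t)$ has a point of sign change. *)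

(* Defs.v *)
From mathcomp Require Import all_boot all_order all_algebra.
From mathcomp Require Import all_classical all_reals all_analysis.

Set Implicit Arguments.
Unset Strict Implicit.
Unset Printing Implicit Defensive.

Import Order.TTheory GRing.Theory Num.Theory.
Import numFieldNormedType.Exports.

Local Open Scope classical_set_scope.
Local Open Scope ring_scope.

(* A function on [Theta] (resp. on [X * Theta]) is represented by a function
   defined on all of [R] (resp. a curried function [X -> R -> R]); the
   definitions below only ever use its values at points of [Theta]. *)

(* Point of sign change, of decreasing type; [f theta] itself is
   unconstrained. *)
Definition sign_change_point (R : realType) (Theta : set R) (f : R -> R)
    (theta : R) : Prop :=
  [/\ Theta theta,
      forall t, Theta t -> t < theta -> 0 < f t &
      forall t, Theta t -> theta < t -> f t < 0].

Definition Psi (R : realType) (X : Type) (Theta : set R) (psi : X -> R -> R)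
    : Prop :=
  forall x : X, exists tp tm : R,
    [/\ Theta tp, Theta tm, tp < tm, 0 < psi x tp & psi x tm < 0].

Definition PsiT (R : realType) (n : nat) (X : Type) (Theta : set R)
    (psi : X -> R -> R) : Prop :=
  Psi Theta psi /\
  forall x : 'I_n -> X, exists theta : R,
    sign_change_point Theta (fun t => \sum_(i < n) psi (x i) t) theta.

(* Main.v *)
Require Import Defs.
From mathcomp Require Import all_boot all_order all_algebra.
From mathcomp Require Import all_classical all_reals all_analysis.
Import Order.TTheory GRing.Theory Num.Theory.
Import numFieldNormedType.Exports.
Local Open Scope classical_set_scope.
Local Open Scope ring_scope.

(** Write [n = k * m]. Repeating an [m]-tuple periodically [k] times gives an
    [n]-tuple whose sum is [k] times the sum of the original one
    ([sum_periodic]). As [k > 0], both sums have the same sign at every point,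
    so a point of sign change for the long sum is one for the short sum. *)

Lemma sum_periodic (V : nmodType) (m k : nat) (m_gt0 : (0 < m)%N)
    (F : 'I_m -> V) :
  \sum_(i < k * m) F (Ordinal (ltn_pmod i m_gt0)) = (\sum_(i < m) F i) *+ k.
Proof.
elim: k => [|k IHk]; first by rewrite big_ord0 mulr0n.
(* The recursion peels off the first period; shifting the remaining indices
   by [m] does not change their residues. *)
rewrite big_split_ord mulrS -IHk /=; congr (_ + _).
  by apply: eq_bigr => i _; congr F; apply: val_inj; rewrite /= modn_small.
by apply: eq_bigr => i _; congr F; apply: val_inj; rewrite /= modnDl.
Qed.

Theorem proposition2p16 (R : realType) (X : Type) (Theta : set R)
    (psi : X -> R -> R)
    (hX : inhabited X)
    (hTheta0 : Theta !=set0) (hThetaO : open Theta)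
    (hThetaI : is_interval Theta)
    (hpsi : Psi Theta psi)
    (n : nat) (hn : (0 < n)%N) (hT : PsiT n Theta psi)
    (m : nat) (hm : (1 <= m <= n)%N) (hmn : (m %| n)%N) :
  PsiT m Theta psi.
Proof.
split=> [//|x].
have /andP[m_gt0 _] := hm.
have [k n_eq] := dvdnP hmn; subst n.
have k_gt0 : (0 < k)%N by move: hn; rewrite muln_gt0 => /andP[].
have [_ /(_ (fun i => x (Ordinal (ltn_pmod i m_gt0))))] := hT.
case=> theta [theta_in pos neg].
exists theta; split=> // t t_in lt_t.
  have := pos t t_in lt_t.
  by rewrite (sum_periodic _ _ _ m_gt0 (fun i => psi (x i) t)) pmulrn_lgt0.
have := neg t t_in lt_t.
by rewrite (sum_periodic _ _ _ m_gt0 (fun i => psi (x i) t)) pmulrn_llt0.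
Qed.
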